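(* Let ${\bf K}=\tau I_{NJ}+\eta GG^{\rm T}$ with $G=2B\otimes I_J+\tau I_N\otimes L_h$, and for $\alpha>0$ let ${\bf P}_{\alpha}={\bf R}_{\alpha}{\bf R}_{\alpha}^{\rm T}$ with ${\bf R}_{\alpha}=(\sqrt{\tau}I_N+2\sqrt{\eta}B_{\alpha})\otimes I_J+\tau\sqrt{\eta}\,I_N\otimes L_h$ and $B_\alpha=B+\alpha\tilde B$. Take $\alpha\in(0,\nu]$ with $$\nu=\min\left\{\frac{\tau}{24\sqrt{\gamma}},\frac{\tau^{3/2}}{2\sqrt{6\gamma}\,T},\frac{\tau^{2}}{8\sqrt{3\gamma}\,T},\frac13\right\}.$$ Let $b\in\mathbb{R}^{NJ}$ be given and let $v$ be the solution of ${\bf P}_{\alpha}^{-1}{\bf K}v={\bf P}_{\alpha}^{-1}b$. Then the preconditioned conjugate gradient (PCG) solver for this preconditioned system has a linear convergence rate independent of the matrix size $NJ$, namely, for every initial guess $v^0\in\mathbb{R}^{NJ}$ and every $k\ge 1$, $$\|v^{k}-v\|_{{\bf K}}\le \frac{2}{3^k}\,\|v^{0}-v\|_{{\bf K}},$$ where $v^k$ denotes the $k$th iterate of PCG started from $v^0$.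
   Context: Setting: $N,J\ge 1$ are integers, $T>0$ and $\gamma>0$ are real numbers, $\tau=T/N$, and $\eta=\gamma/\tau$. $I_k$ is the $k\times k$ identity matrix and $\otimes$ is the Kronecker product. $L_h\in\mathbb{R}^{J\times J}$ is a real symmetric positive semi-definite matrix (a central difference discretization of $-\nabla\cdot(a(x)\nabla)$ with $a\ge 0$). Set $q_0=1$ and $q_k=2(-1)^k$ for $k\ge 1$. $B\in\mathbb{R}^{N\times N}$ is the lower triangular Toeplitz matrix with $B(i,j)=q_{i-j}$ for $i\ge j$ and $B(i,j)=0$ for $i<j$. $\tilde B\in\mathbb{R}^{N\times N}$ is the strictly upper triangular Toeplitz matrix with $\tilde B(i,j)=q_{N-(j-i)}$ for $j>i$ and $\tilde B(i,j)=0$ for $j\le i$ (so its first row is $(0,q_{N-1},\ldots,q_1)$). For $\alpha$ in the stated range, ${\bf P}_\alpha$ is symmetric positive definite, and ${\bf K}$ is symmetric positive definite. The norm is $\|x\|_{{\bf K}}=(x^{\rm T}{\bf K}x)^{1/2}$. PCG (in exact arithmetic) for ${\bf K}v=b$ with symmetric positive definite preconditioner ${\bf P}_\alpha$ and initial guess $v^0$: the $k$th iterate $v^k$ is the unique minimizer of $\|w-v\|_{{\bf K}}$ over $w\in v^0+\mathrm{span}\{z_0,({\bf P}_\alpha^{-1}{\bf K})z_0,\ldots,({\bf P}_\alpha^{-1}{\bf K})^{k-1}z_0\}$, where $z_0={\bf P}_\alpha^{-1}(b-{\bf K}v^0)$ (if the algorithm has already reached the exact solution, subsequent iterates equal $v$).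 *)

(* Defs.v *)
From mathcomp Require Import all_boot all_order all_algebra.
From mathcomp Require Import mxtens.
From mathcomp Require Import reals exp.

Set Implicit Arguments.
Unset Strict Implicit.
Unset Printing Implicit Defensive.

Import Order.TTheory GRing.Theory Num.Theory.
Local Open Scope ring_scope.

Definition psdmx (R : realType) n (A : 'M[R]_n) : Prop :=
  A^T = A /\ forall x : 'cV[R]_n, 0 <= (x^T *m A *m x) 0 0.

Definition mxnorm_of (R : realType) n (A : 'M[R]_n) (x : 'cV[R]_n) : R :=
  Num.sqrt ((x^T *m A *m x) 0 0).

Section AllAtOnce.
Variables (R : realType) (N J : nat).
Implicit Types (T gamma alpha : R) (L : 'M[R]_J).

Definition qcoef (k : nat) : R := if k == 0%N then 1 else 2 * (-1) ^+ k.

Definition Bmx : 'M[R]_N :=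
  \matrix_(i, j) (if (j <= i)%N then qcoef (i - j) else 0).

Definition Btilde : 'M[R]_N :=
  \matrix_(i, j) (if (i < j)%N then qcoef (N - (j - i)) else 0).

Definition Balpha alpha : 'M[R]_N := Bmx + alpha *: Btilde.

Definition tau T : R := T / N%:R.
Definition eta T gamma : R := gamma / tau T.

(* [tensmx] is the Kronecker product: the entry of [A *t B] in row i1 * J + i2
   and column j1 * J + j2 is A i1 j1 * B i2 j2. *)
Definition Gmx T L : 'M[R]_(N * J) :=
  (2 *: Bmx) *t 1%:M + (tau T *: 1%:M) *t L.

Definition Kmx T gamma L : 'M[R]_(N * J) :=
  tau T *: 1%:M + eta T gamma *: (Gmx T L *m (Gmx T L)^T).

Definition Ralpha T gamma L alpha : 'M[R]_(N * J) :=
  (Num.sqrt (tau T) *: 1%:M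
     + (2 * Num.sqrt (eta T gamma)) *: Balpha alpha) *t 1%:M
  + ((tau T * Num.sqrt (eta T gamma)) *: 1%:M) *t L.

Definition Palpha T gamma L alpha : 'M[R]_(N * J) :=
  Ralpha T gamma L alpha *m (Ralpha T gamma L alpha)^T.

Definition nu T gamma : R :=
  Num.min (tau T / (24 * Num.sqrt gamma))
    (Num.min (tau T `^ (3 / 2) / (2 * Num.sqrt (6 * gamma) * T))
      (Num.min (tau T ^+ 2 / (8 * Num.sqrt (3 * gamma) * T)) (1 / 3))).

End AllAtOnce.

Section PCG.
Variables (R : realType) (n : nat).

Definition pcg_space (K P : 'M[R]_n) (b v0 : 'cV[R]_n) (k : nat)
    (w : 'cV[R]_n) : Prop :=
  let z0 := invmx P *m (b - K *m v0) in
  w - v0 \in <<[seq (invmx P *m K) ^+ i *m z0 | i <- iota 0 k]>>%VS.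

(* Here v is the exact solution of K v = b, and w is a k-th PCG iterate when it
   minimizes the K-norm error over the affine Krylov space. *)
Definition pcg_iterate (K P : 'M[R]_n) (b v v0 : 'cV[R]_n) (k : nat)
    (w : 'cV[R]_n) : Prop :=
  pcg_space K P b v0 k w /\
  forall w', pcg_space K P b v0 k w' ->
    mxnorm_of K (w - v) <= mxnorm_of K (w' - v).

End PCG.

(* Main.v *)
(* The symbol of B is (1 - z)/(1 + z), so that B + B^T = 2 u u^T >= 0 with
   u_i = (-1)^i, and hence K <= R_0 R_0^T <= 2 K for the unperturbed factor R_0.
   Moreover Btilde + Btilde^T = 2 (-1)^N (u u^T - I), and the Frobenius norm of
   Btilde is at most sqrt 2 * N; this makes the perturbation small enough that
   2/3 K <= P_alpha <= 8/3 K, with spectral ratio 4 = ((3 + 1)/(3 - 1))^2.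

   The Chebyshev bound is obtained without diagonalization: for X self-adjoint
   with -1 <= X <= 1, the Pell identity T_k^2 + (1 - X^2) U_(k-1)^2 = 1 gives
   |T_k(X) e| <= |e|, and T_k(5/3) = (3^k + 3^-k)/2. *)

Require Import Defs.
From mathcomp Require Import all_boot all_order all_algebra.
From mathcomp Require Import mxtens ring lra.
From mathcomp Require Import reals.

Set Implicit Arguments.
Unset Strict Implicit.
Unset Printing Implicit Defensive.

Import Order.TTheory GRing.Theory Num.Theory.
Local Open Scope ring_scope.

(** * Bilinear forms of matrices and definiteness *)

Definition mxform (R : pzRingType) n (M : 'M[R]_n) (x y : 'cV[R]_n) : R :=
  (x^T *m M *m y) 0 0.

Section BilinearForm.
Variables (R : comPzRingType) (n : nat).
Implicit Types (M : 'M[R]_n) (x y z : 'cV[R]_n).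

Lemma mxformDl M x y z : mxform M (x + y) z = mxform M x z + mxform M y z.
Proof. by rewrite /mxform linearD /= !mulmxDl mxE. Qed.

Lemma mxformDr M x y z : mxform M z (x + y) = mxform M z x + mxform M z y.
Proof. by rewrite /mxform mulmxDr mxE. Qed.

Lemma mxformNl M x y : mxform M (- x) y = - mxform M x y.
Proof. by rewrite /mxform linearN /= !mulNmx mxE. Qed.

Lemma mxformNr M x y : mxform M x (- y) = - mxform M x y.
Proof. by rewrite /mxform mulmxN mxE. Qed.

Lemma mxformZl M a x y : mxform M (a *: x) y = a * mxform M x y.
Proof. by rewrite /mxform linearZ /= -!scalemxAl mxE. Qed.

Lemma mxformZr M a x y : mxform M x (a *: y) = a * mxform M x y.
Proof. by rewrite /mxform -scalemxAr mxE. Qed.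

Lemma mxform0r M x : mxform M x 0 = 0.
Proof. by rewrite /mxform mulmx0 mxE. Qed.

Lemma mxformDm M1 M2 x y : mxform (M1 + M2) x y = mxform M1 x y + mxform M2 x y.
Proof. by rewrite /mxform mulmxDr mulmxDl mxE. Qed.

Lemma mxformNm M x y : mxform (- M) x y = - mxform M x y.
Proof. by rewrite /mxform mulmxN mulNmx mxE. Qed.

Lemma mxformZm a M x y : mxform (a *: M) x y = a * mxform M x y.
Proof. by rewrite /mxform -scalemxAr -scalemxAl mxE. Qed.

Lemma mxform_tr M x y : mxform M x y = mxform M^T y x.
Proof.
rewrite /mxform; have -> : y^T *m M^T *m x = (x^T *m M *m y)^T.
  by rewrite !trmx_mul trmxK mulmxA.
by rewrite [RHS]mxE.
Qed.

Lemma mxform_mul p (M1 : 'M[R]_(n, p)) (M2 : 'M[R]_(p, n)) x y :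
  mxform (M1 *m M2) x y = mxform 1%:M (M1^T *m x) (M2 *m y).
Proof. by rewrite /mxform mulmx1 trmx_mul trmxK !mulmxA. Qed.

Lemma mxformE M x y : mxform M x y = \sum_i \sum_j x i 0 * M i j * y j 0.
Proof.
rewrite /mxform mxE exchange_big /=; apply: eq_bigr => j _.
by rewrite mxE mulr_suml; apply: eq_bigr => i _; rewrite !mxE.
Qed.

End BilinearForm.

Definition mxform_simpl :=
  (mxformDl, mxformDr, mxformNl, mxformNr, mxformZl, mxformZr).

Lemma mxform1_ge0 (R : realDomainType) n (x : 'cV[R]_n) : 0 <= mxform 1%:M x x.
Proof.
by rewrite /mxform mulmx1 mxE sumr_ge0 // => i _; rewrite mxE -expr2 sqr_ge0.
Qed.

Lemma mxform1_gt0 (R : realDomainType) n (x : 'cV[R]_n) :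
  x != 0 -> 0 < mxform 1%:M x x.
Proof.
move=> x0; rewrite lt_def mxform1_ge0 andbT; apply: contra_neq x0 => fx0.
apply/matrixP => i j; rewrite ord1 [RHS]mxE; apply/eqP; rewrite -sqrf_eq0.
have ge0 k : true -> 0 <= x k 0 ^+ 2 by rewrite sqr_ge0.
have /eqP := fx0; rewrite /mxform mulmx1 mxE.
under eq_bigr do rewrite mxE -expr2.
by rewrite (psumr_eq0 _ ge0) => /allP/(_ i (mem_index_enum i)).
Qed.

(** A nonzero row in the left kernel of [P], transposed, would be a vector at which the form
    vanishes. *)
Lemma posdef_unitmx (R : realFieldType) n (P : 'M[R]_n) :
  (forall x, x != 0 -> 0 < mxform P x x) -> P \in unitmx.
Proof.
move=> Ppos; rewrite -row_free_unit -kermx_eq0; apply/eqP/row_matrixP => i.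
rewrite row0; apply/eqP; apply: contraT => ki0.
have /Ppos : (row i (kermx P))^T != 0 by rewrite -(inj_eq trmx_inj) trmxK trmx0.
by rewrite /mxform trmxK -row_mul mulmx_ker row0 mul0mx mxE ltxx.
Qed.

(** * Orthogonal projection and best approximation in the energy norm *)

Section InnerProduct.
Variables (R : realType) (n : nat) (K : 'M[R]_n).
Hypothesis K_sym : K^T = K.
Hypothesis K_gt0 : forall x, x != 0 -> 0 < mxform K x x.

Lemma mxform_sym x y : mxform K x y = mxform K y x.
Proof. by rewrite mxform_tr K_sym. Qed.

Lemma mxform_ge0 x : 0 <= mxform K x x.
Proof. by have [->|/K_gt0/ltW//] := eqVneq x 0; rewrite mxform0r. Qed.

Lemma mxform_eq0 x : mxform K x x = 0 -> x = 0.
Proof. by have [//|/K_gt0 + fx] := eqVneq x 0; rewrite fx ltxx. Qed.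

(** Gram-Schmidt along the list: [x] enters through its component [x'] orthogonal to the span of the
    tail. *)
Lemma orthogonal_projection (s : seq 'cV[R]_n) e :
  exists2 w, w \in <<s>>%VS & forall u, u \in <<s>>%VS -> mxform K (e - w) u = 0.
Proof.
elim: s e => [|x s IH] e.
  exists 0; first exact: mem0v.
  by move=> u; rewrite span_nil memv0 => /eqP->; rewrite mxform0r.
have [w1 w1s w1P] := IH e; have [w2 w2s w2P] := IH x.
have sub u : u \in <<s>>%VS -> u \in <<x :: s>>%VS.
  by move=> us; rewrite span_cons (subvP (addvSr _ _)).
have xs : x \in <<x :: s>>%VS by rewrite memv_span ?mem_head.
set x' := x - w2; set c := mxform K (e - w1) x' / mxform K x' x'.
exists (w1 + c *: x').
  by apply: rpredD; [exact: sub | apply: rpredZ; apply: rpredB => //; exact: sub].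
move=> u; rewrite span_cons => /memv_addP[_ /vlineP[a ->] [y ys ->]].
have -> : a *: x + y = a *: x' + (a *: w2 + y).
  by rewrite /x' scalerBr addrA subrK.
set z := a *: w2 + y; have zs : z \in <<s>>%VS by rewrite rpredD ?rpredZ.
have {}w1P := w1P z zs; have {}w2P := w2P z zs.
rewrite opprD addrA /c; move: (e - w1) w1P => d dz.
(* If [x] already lies in the span of the tail, then [x' = 0] and the correction vanishes. *)
have [x0|x0] := eqVneq (mxform K x' x') 0.
  rewrite (mxform_eq0 x0).
  by rewrite !scaler0 subr0 add0r dz.
rewrite mxformDr mxformZr !(mxformDl _ d) !mxformNl !mxformZl dz.
rewrite (w2P : mxform K x' z = 0).
by field.
Qed.

(** The minimizer is [v0] plus the projection of [v - v0]. By Pythagoras the squared error of a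
    competitor exceeds the minimum by its squared distance to the minimizer, whence uniqueness. *)
Lemma unique_minimizer (s : seq 'cV[R]_n) (v v0 : 'cV[R]_n) :
  exists w, unique (fun w => w - v0 \in <<s>>%VS /\
    forall w', w' - v0 \in <<s>>%VS ->
      mxnorm_of K (w - v) <= mxnorm_of K (w' - v)) w.
Proof.
have [w ws wP] := orthogonal_projection s (v - v0).
have pyth u : u - v0 \in <<s>>%VS ->
    mxform K (u - v) (u - v) = mxform K (v0 + w - v) (v0 + w - v)
      + mxform K (u - (v0 + w)) (u - (v0 + w)).
  move=> us; set d := u - (v0 + w).
  have ds : d \in <<s>>%VS by rewrite /d opprD addrA rpredB.
  have -> : u - v = d - (v - v0 - w).
    by rewrite /d !opprB opprD; apply/matrixP => i j; rewrite !mxE; ring.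
  have -> : v0 + w - v = - (v - v0 - w).
    by apply/matrixP => i j; rewrite !mxE; ring.
  have dr : mxform K (v - v0 - w) d = 0 by exact: wP.
  move: d {ds} (v - v0 - w) dr => d r dr.
  by rewrite !mxform_simpl (mxform_sym d r) dr; ring.
exists (v0 + w); split; first split.
- by rewrite addrAC subrr add0r.
- move=> u us; rewrite ler_sqrt ?mxform_ge0 // -!/(mxform K _ _) (pyth u us).
  by rewrite lerDl mxform_ge0.
- move=> u [us uP]; have /uP : v0 + w - v0 \in <<s>>%VS.
    by rewrite addrAC subrr add0r.
  rewrite ler_sqrt ?mxform_ge0 // -!/(mxform K _ _) (pyth u us).
  rewrite gerDl => h; apply/esym/eqP; rewrite -subr_eq0; apply/eqP.
  by apply: mxform_eq0; apply/le_anti; rewrite h mxform_ge0.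
Qed.

End InnerProduct.

(** * Chebyshev polynomials on Krylov spaces *)

Section ChebyshevIteration.
Variables (R : realType) (n : nat) (K A : 'M[R]_n) (d : R).
Implicit Types x y z e : 'cV[R]_n.
Hypothesis K_sym : K^T = K.
Hypothesis K_gt0 : forall x, x != 0 -> 0 < mxform K x x.
Hypothesis A_sym : forall x y, mxform K (A *m x) y = mxform K x (A *m y).
Hypothesis A_ge : forall x, mxform K x x <= d * mxform K (A *m x) x.
Hypothesis A_le : forall x, d * mxform K (A *m x) x <= 4 * mxform K x x.

(* The spectrum [1/d, 4/d] of A is mapped onto [-1, 1], and 0 to 5/3. *)
Let X : 'M[R]_n := (5 / 3) *: 1%:M - (2 / 3 * d) *: A.

Let XE x : X *m x = (5 / 3) *: x - (2 / 3 * d) *: (A *m x).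
Proof. by rewrite /X mulmxBl -!scalemxAl mul1mx. Qed.

Let X_sym x y : mxform K (X *m x) y = mxform K x (X *m y).
Proof. by rewrite !XE !mxform_simpl A_sym. Qed.

(* 2 (1 - X^2) = (1 - X) (1 + X) (1 - X) + (1 + X) (1 - X) (1 + X). *)
Let X_contraction x : mxform K (X *m x) (X *m x) <= mxform K x x.
Proof.
have Xle y : mxform K (X *m y) y <= mxform K y y.
  by have := A_ge y; rewrite XE !mxform_simpl; lra.
have Xge y : - mxform K y y <= mxform K (X *m y) y.
  by have := A_le y; rewrite XE !mxform_simpl; lra.
have := Xle (x + X *m x); have := Xge (x - X *m x).
rewrite !mulmxDr !mulmxN !mxform_simpl.
rewrite (X_sym (X *m x) x) (X_sym x (X *m x)) (mxform_sym K_sym x (X *m x)).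
by rewrite (X_sym x x) (mxform_sym K_sym x (X *m x)); lra.
Qed.

Let krylov (z : 'cV[R]_n) k := [seq A ^+ i *m z | i <- iota 0 k].

Let krylov_mono z k l x :
  (k <= l)%N -> x \in <<krylov z k>>%VS -> x \in <<krylov z l>>%VS.
Proof.
move=> kl; apply/subvP/sub_span => _ /mapP[i + ->].
rewrite mem_iota => /andP[_ ik]; apply: map_f.
by rewrite mem_iota /= (leq_trans ik).
Qed.

Let krylov_mul z k x :
  x \in <<krylov z k>>%VS -> A *m x \in <<krylov z k.+1>>%VS.
Proof.
move=> /coord_span->; rewrite linear_sum rpred_sum // => i _.
have ik : (i < k)%N.
  by rewrite (leq_trans (ltn_ord i)) // size_map size_iota.
rewrite linearZ rpredZ //= (nth_map 0%N) ?size_iota // nth_iota // add0n.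
rewrite mulmxA (_ : A *m A ^+ i = A ^+ i.+1); last by rewrite exprS.
by apply/memv_span/mapP; exists i.+1; rewrite // mem_iota.
Qed.

(** The membership says that [x] is a polynomial in [A] applied to [e], with constant term [a]. At
    [A = 0] the factor [X] equals 5/3. *)
Let krylov_X e k x a :
  x - a *: e \in <<krylov (- (A *m e)) k>>%VS ->
  X *m x - (5 / 3 * a) *: e \in <<krylov (- (A *m e)) k.+1>>%VS.
Proof.
move=> xk; have -> : X *m x - (5 / 3 * a) *: e =
   (5 / 3) *: (x - a *: e) - (2 / 3 * d) *: (A *m (x - a *: e))
   + (2 / 3 * d * a) *: - (A *m e).
  rewrite XE mulmxBr -scalemxAr.
  by apply/matrixP => i j; rewrite !mxE; ring.
apply: rpredD; first apply: rpredB; apply: rpredZ.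
- exact: krylov_mono xk.
- exact: krylov_mul.
- by apply: memv_span; rewrite /krylov /= mul1mx mem_head.
Qed.

(* With p = U_(k-1)(X) e and q = U_k(X) e (Chebyshev polynomials of the second
   kind), q - X p = T_k(X) e. *)
Let chebyshev_seq e k : exists p q : 'cV[R]_n,
  [/\ p - (3 / 8 * (3 ^+ k - 3 ^- k)) *: e
        \in <<krylov (- (A *m e)) k.-1>>%VS,
      q - (3 / 8 * (3 ^+ k.+1 - 3 ^- k.+1)) *: e
        \in <<krylov (- (A *m e)) k>>%VS
    & mxform K q q - 2 * mxform K (X *m p) q + mxform K p p = mxform K e e].
Proof.
elim: k => [|k [p [q [pk qk pq]]]].
  exists 0, e; split.
  - by rewrite expr0 invr1 subrr mulr0 scale0r subr0 mem0v.
  - rewrite expr1 (_ : _ * _ = 1); last by field.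
    by rewrite scale1r subrr mem0v.
  - by rewrite mulmx0 !(mxform_sym K_sym 0) !mxform0r; ring.
(* The recurrence U_(k+1) = 2 X U_k - U_(k-1). With exp t = 3 one has cosh t = 5/3 and sinh t = 4/3,
   so 3/8 (3^k - 3^-k) is sinh (k t) / sinh t = U_(k-1)(5/3). *)
exists q, (2 *: (X *m q) - p); split => //.
- have k3 : (3 : R) ^+ k != 0 by rewrite expf_neq0 // pnatr_eq0.
  set a := 3 / 8 * (3 ^+ k - 3 ^- k) in pk.
  set b := 3 / 8 * (3 ^+ k.+1 - 3 ^- k.+1) in qk.
  have -> : 3 / 8 * (3 ^+ k.+2 - 3 ^- k.+2) = 2 * (5 / 3 * b) - a.
    by rewrite /a /b !exprS; field; rewrite k3.
  have -> : 2 *: (X *m q) - p - (2 * (5 / 3 * b) - a) *: e =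
      2 *: (X *m q - (5 / 3 * b) *: e) - (p - a *: e).
    by apply/matrixP => i j; rewrite !mxE; ring.
  apply: rpredB; first by apply: rpredZ; exact: krylov_X.
  by apply: krylov_mono pk; rewrite (leq_trans (leq_pred _)).
- rewrite -pq !mxform_simpl.
  by rewrite (mxform_sym K_sym p (X *m q)) -X_sym
    (mxform_sym K_sym (X *m q) p) -X_sym; ring.
Qed.

Lemma chebyshev_krylov e k : (0 < k)%N -> exists2 t : 'cV[R]_n,
  t - e \in <<krylov (- (A *m e)) k>>%VS &
  mxnorm_of K t <= 2 / 3 ^+ k * mxnorm_of K e.
Proof.
move=> k0; have [p [q [pk qk pq]]] := chebyshev_seq e k.
have k3 : 0 < (3 : R) ^+ k by rewrite exprn_gt0.
(* [c] is T_k(5/3), the coefficient of [e] in T_k(X) e. Dividing by it normalizes that coefficient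
   to 1, and [c >= 3^k / 2] gives the rate. *)
pose c : R := (3 ^+ k + 3 ^- k) / 2.
have c_ge : 3 ^+ k / 2 <= c by rewrite ler_pM2r ?invr_gt0 // lerDl invr_ge0 ltW.
have c0 : 0 < c by rewrite (lt_le_trans _ c_ge) // divr_gt0.
(* Multiplication by [X] raises the Krylov index from [k.-1] to [k], as [0 < k]. *)
have {}pk := krylov_X pk; rewrite prednK // in pk.
set t := q - X *m p; exists (c^-1 *: t).
  have -> : c^-1 *: t - e = c^-1 *: (q - (3 / 8 * (3 ^+ k.+1 - 3 ^- k.+1)) *: e
    - (X *m p - (5 / 3 * (3 / 8 * (3 ^+ k - 3 ^- k))) *: e)).
    rewrite /t /c exprS; apply/matrixP => i j; rewrite !mxE; field.
    by rewrite !gt_eqF // addr_gt0 // mulr_gt0.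
  by rewrite rpredZ // rpredB.
(* By the Pell invariant, the squared norm of [t] is that of [e], minus that of [p], plus that of
   [X *m p]. *)
have t_le : mxform K t t <= mxform K e e.
  have := X_contraction p; rewrite -pq /t !mxform_simpl.
  by rewrite (mxform_sym K_sym q (X *m p)); lra.
rewrite /mxnorm_of -!/(mxform K _ _) mxformZl mxformZr mulrA -expr2.
rewrite sqrtrM ?sqr_ge0 // sqrtr_sqr gtr0_norm ?invr_gt0 //.
apply: ler_pM; rewrite ?invr_ge0 ?sqrtr_ge0 ?(ltW c0) //.
  by rewrite -invf_div lef_pV2 // posrE divr_gt0.
by rewrite ler_sqrt // mxform_ge0.
Qed.

End ChebyshevIteration.

(** * From spectral equivalence to the PCG rate *)

Section PreconditionedCG.
Variables (R : realType) (n : nat) (K P : 'M[R]_n) (c : R).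
Implicit Types x y z : 'cV[R]_n.
Hypotheses (K_sym : K^T = K) (P_sym : P^T = P) (c_gt0 : 0 < c).
Hypothesis K_gt0 : forall x, x != 0 -> 0 < mxform K x x.
Hypothesis P_ge : forall x, c * mxform K x x <= mxform P x x.
Hypothesis P_le : forall x, mxform P x x <= 4 * c * mxform K x x.

Let P_unit : P \in unitmx.
Proof.
apply: posdef_unitmx => x x0.
by apply: lt_le_trans (P_ge x); rewrite mulr_gt0 ?K_gt0.
Qed.

Let mulPA x : P *m (invmx P *m K *m x) = K *m x.
Proof. by rewrite !mulmxA mulmxV // mul1mx. Qed.

Let mxform_KP x y : mxform K x y = mxform P x (invmx P *m K *m y).
Proof. by rewrite /mxform -[RHS]/((_ *m P *m _) 0 0) -!(mulmxA x^T) mulPA. Qed.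

(** Both sides equal the [P]-form of [invmx P *m K *m x] and [invmx P *m K *m y]. *)
Let A_sym x y :
  mxform K (invmx P *m K *m x) y = mxform K x (invmx P *m K *m y).
Proof. by rewrite mxform_KP (mxform_sym P_sym) -mxform_KP (mxform_sym K_sym). Qed.

(** Inverts [P <= 4 c K] without square roots: expand the nonnegative [P]-form at [z - e *: x],
    where P(z, z) = K(z, x) and P(z, x) = K(x, x). *)
Let A_ge x : mxform K x x <= 4 * c * mxform K (invmx P *m K *m x) x.
Proof.
set z := invmx P *m K *m x; set e := (4 * c)^-1.
have P_ge0 y : 0 <= mxform P y y.
  by apply: le_trans (P_ge y); rewrite mulr_ge0 ?mxform_ge0 // ltW.
have := P_ge0 (z - e *: x); rewrite !mxform_simpl (mxform_sym P_sym z x) -!mxform_KP.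
have e0 : 0 < e by rewrite invr_gt0 mulr_gt0.
have ce : 4 * c * e = 1 by rewrite /e mulfV // gt_eqF // mulr_gt0.
have : e ^+ 2 * mxform P x x <= e * mxform K x x.
  rewrite (_ : e * _ = e ^+ 2 * (4 * c * mxform K x x)); last first.
    by transitivity (4 * c * e * (e * mxform K x x)); [rewrite ce mul1r | ring].
  by rewrite ler_pM2l ?P_le // exprn_gt0.
move=> h1 h2; rewrite -(ler_pM2l e0) mulrA (mulrC e (4 * c)) ce mul1r; lra.
Qed.

(** Combines c K(z, z) <= P(z, z) = K(z, x) with the nonnegative [K]-form at [z - c^-1 *: x]. *)
Let A_le x : 4 * c * mxform K (invmx P *m K *m x) x <= 4 * mxform K x x.
Proof.
set z := invmx P *m K *m x.
have := mxform_ge0 K_gt0 (z - c^-1 *: x).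
rewrite !mxform_simpl (mxform_sym K_sym x z).
have : c * mxform K z z <= mxform K z x.
  by apply: le_trans (P_ge z) _; rewrite mxform_KP.
rewrite -(ler_pM2l (_ : 0 < c^-1)) ?invr_gt0 // mulKf ?gt_eqF // => h1 h2.
have : c^-1 * mxform K z x <= c^-1 * (c^-1 * mxform K x x) by lra.
rewrite ler_pM2l ?invr_gt0 // -(ler_pM2l c_gt0) mulVKf ?gt_eqF //.
by lra.
Qed.

Lemma pcg_rate (b v v0 : 'cV[R]_n) k :
  invmx P *m K *m v = invmx P *m b -> (0 < k)%N ->
  exists2 vk : 'cV[R]_n, unique (pcg_iterate K P b v v0 k) vk &
    mxnorm_of K (vk - v) <= 2 / 3 ^+ k * mxnorm_of K (v0 - v).
Proof.
move=> Kv k0.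
have [t tk t_le] := chebyshev_krylov K_sym K_gt0 A_sym A_ge A_le (v0 - v) k0.
(* The initial preconditioned residual is the vector that starts the Krylov spaces of the Chebyshev
   bound. *)
have z0E : - (invmx P *m K *m (v0 - v)) = invmx P *m (b - K *m v0).
  by rewrite !mulmxBr opprB Kv !mulmxA.
rewrite z0E in tk.
pose s := [seq (invmx P *m K) ^+ i *m (invmx P *m (b - K *m v0)) | i <- iota 0 k].
have [w [[ws wmin] wuniq]] := unique_minimizer K_sym K_gt0 s v v0.
exists w; first by split; [split|].
(* The Chebyshev error [t] is attained by the competitor [t + v], so the minimizer does at least as
   well. *)
apply: le_trans t_le; have := wmin (t + v); rewrite addrK; apply.
by rewrite -addrA -(opprB v0).
Qed.

End PreconditionedCG.

(** * Quadratic forms of Kronecker products *)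

Lemma mxform_tens (R : comPzRingType) m n (A : 'M[R]_m) (B : 'M[R]_n) x :
  mxform (A *t B) x x = \sum_i \sum_j \sum_i' \sum_j'
    x (mxtens_index (i, j)) 0 * (A i i' * B j j') * x (mxtens_index (i', j')) 0.
Proof.
have reidx (F : 'I_(m * n) -> R) :
    \sum_k F k = \sum_i \sum_j F (mxtens_index (i, j)).
  rewrite pair_big (reindex (@mxtens_index m n)).
    by apply: eq_bigr => -[].
  by exists (@mxtens_unindex m n) => k _; rewrite (mxtens_indexK, mxtens_unindexK).
rewrite mxformE reidx; apply: eq_bigr => i _; apply: eq_bigr => j _.
rewrite reidx; apply: eq_bigr => i' _; apply: eq_bigr => j' _.
by rewrite tensmxE.
Qed.

(** The form splits into the forms of [B] at the consecutive blocks of [x]. *)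
Lemma mxform_tens1mx_ge0 (R : realDomainType) m n (B : 'M[R]_n) x :
  (forall y, 0 <= mxform B y y) -> 0 <= mxform (1%:M *t B : 'M_(m * n)) x x.
Proof.
move=> B0; rewrite mxform_tens sumr_ge0 // => i _.
have := B0 (\col_j x (mxtens_index (i, j)) 0); rewrite mxformE.
congr (0 <= _); apply: eq_bigr => j _; rewrite [RHS](bigD1 i) //=.
rewrite [X in _ + X]big1 ?addr0; last first.
  move=> i' i'i; rewrite big1 // => j' _.
  by rewrite mxE eq_sym (negPf i'i) mul0r mulr0 mul0r.
by apply: eq_bigr => j' _; rewrite !mxE eqxx mul1r.
Qed.

(** Here [x] is sliced the other way: one vector for each fixed second index [j]. *)
Lemma mxform_tensmx1_ge0 (R : realDomainType) m n (A : 'M[R]_m) x :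
  (forall y, 0 <= mxform A y y) -> 0 <= mxform (A *t 1%:M : 'M_(m * n)) x x.
Proof.
move=> A0; rewrite mxform_tens exchange_big sumr_ge0 //= => j _.
have := A0 (\col_i x (mxtens_index (i, j)) 0); rewrite mxformE.
congr (0 <= _); apply: eq_bigr => i _; apply: eq_bigr => i' _.
rewrite [RHS](bigD1 j) //= [X in _ + X]big1 ?addr0.
  by rewrite !mxE eqxx mulr1.
by move=> j' j'j; rewrite !mxE eq_sym (negPf j'j) !mulr0 mul0r.
Qed.

Section AdditiveTensor.
Variables (R : comPzRingType) (m n : nat).

Lemma tensmx11 : (1%:M : 'M[R]_m) *t (1%:M : 'M[R]_n) = 1%:M.
Proof.
apply/matrixP => k l; have [i j] := mxtens_indexP k; have [i' j'] := mxtens_indexP l.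
rewrite tensmxE !mxE -natrM mulnb; congr (_%:R).
by rewrite (inj_eq (can_inj (@mxtens_indexK m n))) xpair_eqE.
Qed.

Lemma tensmxDl (A B : 'M[R]_m) (C : 'M[R]_n) : (A + B) *t C = A *t C + B *t C.
Proof. by apply/matrixP => k l; rewrite !mxE mulrDl. Qed.

Lemma tensmxZl a (A : 'M[R]_m) (C : 'M[R]_n) : (a *: A) *t C = a *: (A *t C).
Proof. by apply/matrixP => k l; rewrite !mxE mulrA. Qed.

Lemma tensmxNl (A : 'M[R]_m) (C : 'M[R]_n) : (- A) *t C = - (A *t C).
Proof. by apply/matrixP => k l; rewrite !mxE mulNr. Qed.

End AdditiveTensor.

(** * Cauchy-Schwarz and the Frobenius bound *)

Lemma sum_CauchySchwarz (R : realDomainType) (I : finType) (f g : I -> R) :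
  (\sum_i f i * g i) ^+ 2 <= (\sum_i f i ^+ 2) * (\sum_i g i ^+ 2).
Proof.
have sum2 (F G : I -> R) : (\sum_i F i) * (\sum_i G i) = \sum_i \sum_j F i * G j.
  by rewrite mulr_suml; apply: eq_bigr => i _; rewrite mulr_sumr.
(* Lagrange's identity: this double sum is twice the gap in the inequality. *)
have : 0 <= \sum_i \sum_j (f i * g j - f j * g i) ^+ 2.
  by apply: sumr_ge0 => i _; apply: sumr_ge0 => j _; rewrite sqr_ge0.
under eq_bigr do under eq_bigr do rewrite sqrrB exprMn.
under eq_bigr do rewrite big_split sumrB /=.
rewrite big_split sumrB /= -sum2.
rewrite [X in _ + X]exchange_big /=.
under [X in _ + X]eq_bigr do under eq_bigr do rewrite exprMn.
rewrite -sum2 (_ : \sum_i \sum_j _ *+ 2 = (\sum_i f i * g i) ^+ 2 *+ 2); last first.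
  rewrite expr2 sum2 -sumrMnl; apply: eq_bigr => i _; rewrite -sumrMnl.
  by apply: eq_bigr => j _; congr (_ *+ 2); ring.
lra.
Qed.

Lemma mxform_mul_tr_le (R : realDomainType) m n (M : 'M[R]_(m, n)) x :
  mxform (M *m M^T) x x <= (\sum_i \sum_j M i j ^+ 2) * mxform 1%:M x x.
Proof.
have -> : mxform 1%:M x x = \sum_i x i 0 ^+ 2.
  by rewrite /mxform mulmx1 mxE; apply: eq_bigr => i _; rewrite mxE expr2.
have -> : mxform (M *m M^T) x x = \sum_j (\sum_i M i j * x i 0) ^+ 2.
  rewrite /mxform mulmxA -(mulmxA (_ *m M)) -{1}(trmxK M) -trmx_mul.
  rewrite mxE; apply: eq_bigr => j _; rewrite !mxE expr2.
  by congr (_ * _); apply: eq_bigr => i _; rewrite mxE.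
rewrite exchange_big mulr_suml /=; apply: ler_sum => j _.
exact: sum_CauchySchwarz.
Qed.

(** * Symmetric parts of the Toeplitz matrices *)

Section AlternatingKernel.
Variables (R : realType) (N : nat).

Definition altcol : 'cV[R]_N := \col_i (-1) ^+ i.

Lemma altcolM i j : (altcol *m altcol^T) i j = (-1) ^+ (i + j).
Proof. by rewrite mxE big_ord1 !mxE exprD. Qed.

(** Off the diagonal, [i - j] and [i + j] have the same parity; on it, q_0 = 1 is doubled to 2. *)
Lemma Bmx_addT : Bmx R N + (Bmx R N)^T = 2 *: (altcol *m altcol^T).
Proof.
apply/matrixP => i j; rewrite [LHS]mxE [RHS]mxE altcolM !mxE.
rewrite /qcoef; have [ij|ji|ij] := ltngtP i j.
- by rewrite subn_eq0 leqNgt ij add0r -signr_odd oddB ?(ltnW ij) // addbC -oddD signr_odd.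
- by rewrite subn_eq0 leqNgt ji addr0 -signr_odd oddB ?(ltnW ji) // -oddD signr_odd.
- by rewrite ij subnn eqxx -signr_odd oddD addbb mulr1.
Qed.

(** The same parity argument, shifted by [N]; the zero diagonal accounts for the subtracted
    identity. *)
Lemma Btilde_addT :
  Btilde R N + (Btilde R N)^T = (2 * (-1) ^+ N) *: (altcol *m altcol^T - 1%:M).
Proof.
have key (i j : 'I_N) : (i < j)%N ->
    qcoef R (N - (j - i)) = 2 * (-1) ^+ N * (-1) ^+ (i + j).
  move=> ij; have jN := ltn_ord j.
  (* This keeps the index [N - (j - i)] positive, away from the exceptional q_0. *)
  have jiN : (j - i < N)%N by rewrite (leq_ltn_trans (leq_subr _ _)).
  rewrite /qcoef subn_eq0 leqNgt jiN -mulrA -exprD.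
  rewrite -signr_odd -[in RHS]signr_odd !oddD oddB ?(ltnW jiN) // oddB ?(ltnW ij) //.
  by rewrite (addbC (odd i)).
apply/matrixP => i j; rewrite [LHS]mxE [RHS]mxE [X in _ * X]mxE altcolM !mxE.
rewrite -val_eqE /=; have [ij|ji|ij] := ltngtP i j.
- by rewrite key // subr0 addr0.
- by rewrite key // subr0 add0r addnC.
- by rewrite ij -[_ ^+ (j + j)]signr_odd oddD addbb subrr mulr0 addr0.
Qed.

Lemma altcol_sum_sqr : \sum_i \sum_j altcol i j ^+ 2 = N%:R.
Proof.
under eq_bigr do rewrite big_ord1 mxE sqrr_sign.
by rewrite sumr_const card_ord.
Qed.

(** Mirror entries are never both nonzero and their squares are at most 4, so twice the sum is at
    most 4 N^2. *)
Lemma Btilde_sum_sqr_le : \sum_i \sum_j Btilde R N i j ^+ 2 <= 2 * N%:R ^+ 2.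
Proof.
set S := \sum_i _.
suff : S + S <= \sum_(i < N) \sum_(j < N) 4.
  rewrite !(sumr_const, card_ord) -mulr_natr -mulr_natr; lra.
rewrite {2}/S exchange_big -big_split /=; apply: ler_sum => i _.
rewrite -big_split /=; apply: ler_sum => j _; rewrite !mxE.
have q2 k : qcoef R k ^+ 2 <= 4.
  by rewrite /qcoef; case: ifP => _; rewrite ?exprMn ?sqrr_sign; lra.
by case: ltngtP => _; rewrite ?expr0n ?addr0 ?add0r ?q2 //=; lra.
Qed.

End AlternatingKernel.

(** * Scalar inequalities for the preconditioner *)

(* The numbers stand for the quadratic forms of the summands of P at a vector:
   [x + g] is that of K, [f] that of the symmetric part of G, [w - y] and [c]
   those of the cross terms linear in alpha, and [d] that of the alpha^2 term. *)
Lemma splitting_bounds (R : realFieldType) (x g d f w y c : R) :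
  0 <= x -> 0 <= g -> d <= 1 / 22 * x -> 0 <= f -> f <= x + g ->
  0 <= w -> w <= 3 / 10 * x -> 0 <= y -> y <= 3 / 10 * x ->
  0 <= g + 5 * c + 25 * d -> 0 <= g - 5 * c + 25 * d ->
  (y <= 3 / 20 * x ->
    2 / 3 * (x + g) <= x + g + d + f + (w - y) + c <= 4 * (2 / 3) * (x + g)) /\
  (w <= f ->
    2 / 3 * (x + g) <= x + g + d + f - (w - y) + c <= 4 * (2 / 3) * (x + g)).
Proof. by move=> *; split=> *; apply/andP; split; lra. Qed.

(** To be read with [sg] = sqrt gamma, [eps] = (-1)^N, g = G^T x and d = (Btilde (x) I)^T x: [X],
    [G], [D] are the squared norms of x, g, d, while [C] = <g, d> and [F] = <x, g>. [U] and [L] are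
    the forms of u u^T (x) I and I (x) L_h. *)
Lemma preconditioner_bounds (R : realFieldType) (ta et al sg nn eps : R)
    (X U L G D C F : R) :
  0 < ta -> 0 < et -> 0 < al -> al <= 1 / 3 -> 0 < sg -> sg ^+ 2 = ta * et ->
  1 <= nn -> (eps = 1 /\ 2 <= nn) \/ eps = -1 ->
  al * sg * nn <= 3 / 40 * ta ->
  0 <= X -> 0 <= U -> U <= nn * X -> 0 <= L -> 0 <= G ->
  D <= 2 * nn ^+ 2 * X ->
  F = 2 * U + ta * L -> 2 * sg * F <= ta * X + et * G ->
  (forall s, s ^+ 2 = 1 -> 0 <= G + s * (20 * al) * C + 100 * al ^+ 2 * D) ->
  2 / 3 * (ta * X + et * G) <=
    ta * X + et * G + 4 * al ^+ 2 * et * D + 2 * sg * F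
      + 4 * (al * sg) * (eps * (U - X)) + 4 * al * et * C
  <= 4 * (2 / 3) * (ta * X + et * G).
Proof.
move=> ta0 et0 al0 al3 sg0 sg2 nn1 epsP mn X0 U0 UX L0 G0 DX FE FK CS.
have m0 : 0 < al * sg by rewrite mulr_gt0.
have nn0 : 0 <= nn by rewrite (le_trans ler01).
have mnX : al * sg * (nn * X) <= 3 / 40 * (ta * X).
  by rewrite !mulrA ler_wpM2r.
have le4 (a b : R) : a <= 3 / 40 * b -> 4 * a <= 3 / 10 * b by clear; lra.
have mU : 4 * (al * sg * U) <= 3 / 10 * (ta * X).
  by apply/le4/(le_trans _ mnX); rewrite ler_wpM2l // ltW.
have mX : 4 * (al * sg * X) <= 3 / 10 * (ta * X).
  by apply/le4/(le_trans _ mnX); rewrite ler_wpM2l ?(ltW m0) // ler_peMl.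
have mX2 : 2 <= nn -> 4 * (al * sg * X) <= 3 / 20 * (ta * X).
  move=> nn2; have : al * sg * (2 * X) <= 3 / 40 * (ta * X).
    by apply/(le_trans _ mnX); rewrite ler_wpM2l ?(ltW m0) // ler_wpM2r.
  by clear; lra.
(* The constant works because 8 (3/40)^2 = 9/200 < 1/22. *)
have D_le : 4 * al ^+ 2 * et * D <= 1 / 22 * (ta * X).
  have an : al ^+ 2 * et * nn ^+ 2 <= (3 / 40) ^+ 2 * ta.
    rewrite -(ler_pM2l ta0).
    have -> : ta * (al ^+ 2 * et * nn ^+ 2) = (al * sg * nn) ^+ 2.
      by rewrite !exprMn sg2; ring.
    have -> : ta * ((3 / 40) ^+ 2 * ta) = (3 / 40 * ta) ^+ 2 by ring.
    by rewrite ler_sqr // nnegrE mulr_ge0 // ltW // divr_gt0.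
  have ae : 0 <= 4 * al ^+ 2 * et by rewrite !mulr_ge0 // ltW.
  apply: le_trans (ler_wpM2l ae DX) _.
  have := ler_wpM2r X0 an; have : 0 <= ta * X by rewrite mulr_ge0 // ltW.
  by clear; lra.
have F0 : 0 <= 2 * sg * F.
  by rewrite FE !mulr_ge0 ?addr_ge0 ?mulr_ge0 // ltW.
have mUF : 4 * (al * sg * U) <= 2 * sg * F.
  have : al * (sg * U) <= 1 / 3 * (sg * U) by rewrite ler_wpM2r // mulr_ge0 // ltW.
  have : 0 <= sg * U by rewrite mulr_ge0 // ltW.
  have : 0 <= sg * (ta * L) by rewrite !mulr_ge0 // ltW.
  by rewrite FE; clear; lra.
have Cs s : s ^+ 2 = 1 ->
    0 <= et * G + s * (5 * (4 * al * et * C)) + 25 * (4 * al ^+ 2 * et * D).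
  move=> /CS /(mulr_ge0 (ltW et0)); congr (0 <= _); ring.
have Cp := Cs 1 (expr1n _ _); have Cm := Cs (-1) (sqrr_sign R 1).
rewrite mul1r in Cp; rewrite mulN1r in Cm.
have x0 : 0 <= ta * X by rewrite mulr_ge0 // ltW.
have g0 : 0 <= et * G by rewrite mulr_ge0 // ltW.
have mU0 : 0 <= 4 * (al * sg * U) by rewrite !mulr_ge0 // ltW.
have mX0 : 0 <= 4 * (al * sg * X) by rewrite !mulr_ge0 // ltW.
(* For even N the subtracted term is that of [X], halved since N >= 2; for odd N it is that of [U],
   absorbed by [F]. *)
have [even odd] := splitting_bounds x0 g0 D_le F0 FK mU0 mU mX0 mX Cp Cm.
have E : 4 * (al * sg) * (U - X) = 4 * (al * sg * U) - 4 * (al * sg * X) by ring.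
case: epsP => [[-> nn2]|->]; first by rewrite mul1r E; exact: even (mX2 nn2).
by rewrite mulN1r mulrN E; exact: odd.
Qed.

(** * Spectral equivalence of K and the preconditioner *)

Section Spectrum.
Variables (R : realType) (N J : nat) (T gamma alpha : R) (L : 'M[R]_J).

(** Isolates [alpha] as a perturbation of [Gmx], so that [Palpha] can be compared with [Kmx] term by
    term. *)
Lemma RalphaE : Ralpha N T gamma L alpha =
  Num.sqrt (tau N T) *: 1%:M + Num.sqrt (eta N T gamma) *:
    (Gmx N T L + (2 * alpha) *: (Btilde R N *t 1%:M)).
Proof.
rewrite /Ralpha /Gmx /Balpha -(tensmx11 R N J).
rewrite !(tensmxDl, tensmxZl) !scalerDr !scalerDl !scalerA.
apply/matrixP => i j; rewrite !mxE; ring.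
Qed.

Let U x := mxform ((altcol R N *m (altcol R N)^T) *t (1%:M : 'M_J)) x x.

(** A quadratic form sees only the symmetric part. *)
Lemma mxform_Bmx x : mxform (Bmx R N *t (1%:M : 'M_J)) x x = U x.
Proof.
have : mxform (Bmx R N *t (1%:M : 'M_J)) x x + mxform (Bmx R N *t (1%:M : 'M_J)) x x
    = 2 * U x.
  rewrite {2}mxform_tr trmx_tens trmx1 -mxformDm -tensmxDl Bmx_addT.
  by rewrite tensmxZl mxformZm.
lra.
Qed.

Lemma mxform_Btilde x : mxform (Btilde R N *t (1%:M : 'M_J)) x x =
  (-1) ^+ N * (U x - mxform 1%:M x x).
Proof.
set b := mxform _ x x.
have : b + b = 2 * (-1) ^+ N * (U x - mxform 1%:M x x).
  rewrite {2}/b mxform_tr trmx_tens trmx1 -mxformDm -tensmxDl Btilde_addT.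
  by rewrite tensmxZl tensmxDl tensmxNl tensmx11 mxformZm mxformDm mxformNm.
lra.
Qed.

Lemma mxform_altcol_ge0 x : 0 <= U x.
Proof.
apply: mxform_tensmx1_ge0 => y; rewrite mxform_mul; exact: mxform1_ge0.
Qed.

Lemma mxform_tensmx1_le (M : 'M[R]_N) c x :
  (forall y, mxform M y y <= c * mxform 1%:M y y) ->
  mxform (M *t (1%:M : 'M_J)) x x <= c * mxform 1%:M x x.
Proof.
move=> Mc; rewrite -subr_ge0 -mxformZm -mxformNm -mxformDm -(tensmx11 R N J).
rewrite -tensmxZl -tensmxNl -tensmxDl.
apply: mxform_tensmx1_ge0 => y.
by rewrite mxformDm mxformNm mxformZm subr_ge0.
Qed.

Lemma mxform_altcol_le x : U x <= N%:R * mxform 1%:M x x.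
Proof.
apply: mxform_tensmx1_le => y; rewrite -(altcol_sum_sqr R N).
exact: mxform_mul_tr_le.
Qed.

Hypotheses (N_gt0 : (0 < N)%N) (T_gt0 : 0 < T) (gamma_gt0 : 0 < gamma).

Let tau_gt0 : 0 < tau N T. Proof. by rewrite divr_gt0 ?ltr0n. Qed.
Let eta_gt0 : 0 < eta N T gamma. Proof. by rewrite divr_gt0. Qed.

Lemma mxform_Kmx x : mxform (Kmx N T gamma L) x x =
  tau N T * mxform 1%:M x x + eta N T gamma *
    mxform 1%:M ((Gmx N T L)^T *m x) ((Gmx N T L)^T *m x).
Proof. by rewrite /Kmx mxformDm !mxformZm -mxform_mul. Qed.

Lemma Kmx_gt0 x : x != 0 -> 0 < mxform (Kmx N T gamma L) x x.
Proof.
move=> x0; rewrite mxform_Kmx; apply: ltr_pwDl; first by rewrite mulr_gt0 ?mxform1_gt0.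
by rewrite mulr_ge0 ?mxform1_ge0 // ltW.
Qed.

Lemma Kmx_sym : (Kmx N T gamma L)^T = Kmx N T gamma L.
Proof.
by rewrite /Kmx linearD !linearZ /= trmx1 trmx_mul trmxK.
Qed.

Lemma Palpha_sym : (Palpha N T gamma L alpha)^T = Palpha N T gamma L alpha.
Proof. by rewrite /Palpha trmx_mul trmxK. Qed.

Hypotheses (L_psd : psdmx L) (alpha_gt0 : 0 < alpha).
Hypothesis alpha_le : alpha <= nu N T gamma.

Let sqrt_tau_eta :
  Num.sqrt (tau N T) * Num.sqrt (eta N T gamma) = Num.sqrt gamma.
Proof.
by rewrite -sqrtrM ?(ltW tau_gt0) // /eta mulrCA mulfV ?mulr1 // gt_eqF.
Qed.

Let alpha_le3 : alpha <= 1 / 3.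
Proof. by move: alpha_le; rewrite /nu !le_min => /and4P[]. Qed.

(** Comes from the third term of [nu] with T = tau N; since sqrt 3 >= 5/3, 1 / (8 sqrt 3) <=
    3/40. *)
Let alpha_gamma :
  alpha * Num.sqrt gamma * N%:R <= 3 / 40 * tau N T.
Proof.
have : alpha <= tau N T ^+ 2 / (8 * Num.sqrt (3 * gamma) * T).
  by move: alpha_le; rewrite /nu !le_min => /and4P[].
have N0 : (0 : R) < N%:R by rewrite ltr0n.
have TE : T = tau N T * N%:R by rewrite /tau divfK // gt_eqF.
have s3 : (5 / 3 : R) <= Num.sqrt 3.
  rewrite -[leLHS]ger0_norm; last lra.
  by rewrite -sqrtr_sqr ler_sqrt; lra.
have sg : 0 < Num.sqrt gamma by rewrite sqrtr_gt0.
rewrite sqrtrM // ler_pdivlMr; last first.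
  by rewrite !mulr_gt0 // (lt_le_trans _ s3) //; lra.
rewrite [X in _ * X](_ : _ =
    tau N T * (8 * (Num.sqrt 3 * (Num.sqrt gamma * N%:R)))); last first.
  by rewrite {1}TE; ring.
rewrite mulrCA expr2 ler_pM2l //.
have : 0 <= alpha * (Num.sqrt gamma * N%:R) by rewrite !mulr_ge0 // ltW.
move=> h; have := ler_wpM2r h s3; lra.
Qed.

Lemma Palpha_bounds x :
  2 / 3 * mxform (Kmx N T gamma L) x x <= mxform (Palpha N T gamma L alpha) x x
    <= 4 * (2 / 3) * mxform (Kmx N T gamma L) x x.
Proof.
set st := Num.sqrt (tau N T); set se := Num.sqrt (eta N T gamma).
have st2 : st ^+ 2 = tau N T by rewrite sqr_sqrtr // ltW.
have se2 : se ^+ 2 = eta N T gamma by rewrite sqr_sqrtr // ltW.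
set g := (Gmx N T L)^T *m x; set d := (Btilde R N *t 1%:M)^T *m x.
have GE : mxform 1%:M x g = 2 * U x + tau N T * mxform (1%:M *t L) x x.
  rewrite /g (_ : mxform _ _ _ = mxform (Gmx N T L) x x); last first.
    by rewrite mxform_tr trmx1 /mxform trmx_mul trmxK mulmx1.
  by rewrite /Gmx !tensmxZl mxformDm !mxformZm mxform_Bmx.
have BE : mxform 1%:M x d = (-1) ^+ N * (U x - mxform 1%:M x x).
  by rewrite -mxform_Btilde mxform_tr trmx1 /mxform trmx_mul trmxK mulmx1.
have PE : mxform (Palpha N T gamma L alpha) x x =
   mxform 1%:M (st *: x + se *: (g + (2 * alpha) *: d))
               (st *: x + se *: (g + (2 * alpha) *: d)).
  rewrite /Palpha mxform_mul RalphaE.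
  have -> // : (st *: 1%:M + se *: (Gmx N T L + (2 * alpha) *: (Btilde R N *t 1%:M)))^T
      *m x = st *: x + se *: (g + (2 * alpha) *: d).
  rewrite linearD !linearZ /= trmx1 [X in se *: X]linearD linearZ /=.
  by rewrite mulmxDl -!scalemxAl mul1mx mulmxDl -scalemxAl.
have sym y z : mxform (1%:M : 'M[R]_(N * J)) y z = mxform 1%:M z y.
  by rewrite mxform_tr trmx1.
have := @preconditioner_bounds R (tau N T) (eta N T gamma) alpha
  (Num.sqrt gamma) N%:R ((-1) ^+ N) (mxform 1%:M x x) (U x)
  (mxform (1%:M *t L) x x) (mxform 1%:M g g) (mxform 1%:M d d)
  (mxform 1%:M g d) (mxform 1%:M x g).
rewrite -BE -mxform_Kmx => H.
have -> : mxform (Palpha N T gamma L alpha) x x =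
    mxform (Kmx N T gamma L) x x
    + 4 * alpha ^+ 2 * eta N T gamma * mxform 1%:M d d
    + 2 * Num.sqrt gamma * mxform 1%:M x g
    + 4 * (alpha * Num.sqrt gamma) * mxform 1%:M x d
    + 4 * alpha * eta N T gamma * mxform 1%:M g d.
  rewrite PE mxform_Kmx -/g -sqrt_tau_eta -/st -/se -st2 -se2.
  rewrite !mxform_simpl (sym g x) (sym d x) (sym d g); ring.
apply: H => //.
- by rewrite sqrtr_gt0.
- by rewrite sqr_sqrtr ?(ltW gamma_gt0) // /eta mulrCA mulfV ?mulr1 // gt_eqF.
- by rewrite ler1n.
(* A positive even N is at least 2. *)
- rewrite -signr_odd; case: (boolP (odd N)) => oN; [right|left].
    by rewrite expr1.
  by split=> //; rewrite ler_nat; case: N N_gt0 oN => [|[]].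
- exact: mxform1_ge0.
- exact: mxform_altcol_ge0.
- exact: mxform_altcol_le.
- by apply: mxform_tens1mx_ge0 => y; apply: L_psd.2.
- exact: mxform1_ge0.
- rewrite /d -mxform_mul; set B1 := _ *t _.
  have -> : B1 *m B1^T = (Btilde R N *m (Btilde R N)^T) *t 1%:M.
    by rewrite /B1 trmx_tens trmx1 tensmx_mul mulmx1.
  apply: mxform_tensmx1_le => y; apply: le_trans (mxform_mul_tr_le _ _) _.
  by rewrite ler_wpM2r ?mxform1_ge0 ?Btilde_sum_sqr_le.
(* Nonnegativity of |sqrt tau x - sqrt eta g|^2. *)
- rewrite mxform_Kmx -/g.
  have := mxform1_ge0 (st *: x - se *: g).
  rewrite !mxform_simpl (sym g x) -sqrt_tau_eta -/st -/se -st2 -se2.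
  lra.
(* The weight 10 makes the cross term of g and d cost only a fifth of the g term, the rest going to
   the small d term. *)
- move=> s s2; have := mxform1_ge0 (g + (s * (10 * alpha)) *: d).
  rewrite !mxform_simpl (sym d g); congr (0 <= _).
  have -> : 100 * alpha ^+ 2 = s ^+ 2 * (100 * alpha ^+ 2) by rewrite s2 mul1r.
  ring.
Qed.

End Spectrum.

Theorem theorem7 (R : realType) (N J : nat) (T gamma : R) (L : 'M[R]_J)
    (alpha : R) (b v : 'cV[R]_(N * J)) :
  (1 <= N)%N -> (1 <= J)%N -> 0 < T -> 0 < gamma -> psdmx L ->
  0 < alpha -> alpha <= nu N T gamma ->
  let K := Kmx N T gamma L in
  let P := Palpha N T gamma L alpha in
  invmx P *m K *m v = invmx P *m b ->
  forall (v0 : 'cV[R]_(N * J)) (k : nat), (1 <= k)%N ->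
  exists2 vk : 'cV[R]_(N * J),
    unique (pcg_iterate K P b v v0 k) vk &
    mxnorm_of K (vk - v) <= 2 / 3 ^+ k * mxnorm_of K (v0 - v).
Proof.
move=> N0 _ T0 g0 Lpsd a0 a_le K P Kv v0 k k0.
(* The bounds 2/3 and 8/3 have the form c and 4 c with c = 2/3. *)
have c0 : (0 : R) < 2 / 3 by lra.
have bnd := Palpha_bounds N0 T0 g0 Lpsd a0 a_le.
apply: (pcg_rate _ _ c0) => //.
- exact: Kmx_sym.
- exact: Palpha_sym.
- exact: Kmx_gt0.
- by move=> x; have /andP[] := bnd x.
- by move=> x; have /andP[] := bnd x.
Qed.
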